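(* Fix a constant $L>0$. Let $D_1,D_2\in\mathbb{C}^{N\times N}$ be Hermitian matrices with $\langle D_l\rangle=0$ and $\|D_l\|\le L$ for $l=1,2$. For $z_l=E_l+\mathrm i\eta_l\in\mathbb H$, $l=1,2$, let $\rho_l:=\pi^{-1}\langle\Im M^{D_l}(z_l)\rangle$, $$\beta_*:=\beta_*(z_1,z_2):=\beta(z_1,z_2)\wedge\beta(z_1,\bar z_2),$$ $$\widehat\gamma:=\widehat\gamma(z_1,z_2):=\langle(D_1-D_2)^2\rangle+\mathrm{LT}(z_1,z_2)+|E_1-E_2|^2\wedge1+\frac{\eta_1}{\rho_1}\wedge1+\frac{\eta_2}{\rho_2}\wedge1.$$ Then, uniformly in $z_1,z_2\in\mathbb H$, $$(\rho_1+\rho_2)^2\lesssim\beta(z_1,z_2).$$ Moreover, fix a constant $C_0>0$ and assume that for some intervals $\mathbf I_1,\mathbf I_2\subset\mathbb R$ we have $$\sup_{\Re z_l\in\mathbf I_l}\|M^{D_l}(z_l)\|\le C_0,\qquad l=1,2.$$ Then, uniformly in $z_l=E_l+\mathrm i\eta_l\in\mathbb H$ with $E_l\in\mathbf I_l$, $l=1,2$, $$\widehat\gamma\lesssim\beta_*\lesssim\widehat\gamma^{1/4},$$ where the implicit constants depend only on $L$ and $C_0$.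
   Context: $\mathbb H=\{z\in\mathbb C:\Im z>0\}$; $\langle X\rangle:=N^{-1}\mathrm{Tr}X$; $\|\cdot\|$ is the operator norm; $a\wedge b=\min\{a,b\}$ (each ''$\wedge1$'' applies to the single term preceding it). $f\lesssim g$ means $f\le Cg$ with a constant $C$ independent of $N$. For Hermitian $D$ and $z\in\mathbb C\setminus\mathbb R$, $M^D(z)$ is the unique solution of $-M^{-1}=z-D+\langle M\rangle$ with $\Im M\,\Im z>0$ (so $M^D(\bar z)=M^D(z)^*$). Write $M_l=M^{D_l}(z_l)$. For $z_1,z_2\in\mathbb C\setminus\mathbb R$ set $\beta(z_1,z_2):=|1-\langle M^{D_1}(z_1)M^{D_2}(z_2)\rangle|$ and $$\mathrm{LT}(z_1,z_2):=\begin{cases}\Big|z_1-z_2-\dfrac{\langle M_1(D_1-D_2)M_2\rangle}{\langle M_1M_2\rangle}\Big|\wedge1,&\Im z_1\Im z_2<0,\\[2mm]\Big|z_1-\bar z_2-\dfrac{\langle M_1(D_1-D_2)M_2^*\rangle}{\langle M_1M_2^*\rangle}\Big|\wedge1,&\Im z_1\Im z_2>0.\end{cases}$$ *)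

(* Defs.v *)
From HB Require Import structures.
From mathcomp Require Import all_boot all_order all_algebra.
From mathcomp Require Import sesquilinear spectral.
From mathcomp Require Import complex.
From mathcomp Require Import all_classical all_reals all_analysis.

Set Implicit Arguments.
Unset Strict Implicit.
Unset Printing Implicit Defensive.

Import Order.TTheory GRing.Theory Num.Theory.
Local Open Scope classical_set_scope.
Local Open Scope ring_scope.
Local Open Scope sesquilinear_scope.
Local Open Scope complex_scope.

Section MatrixNotions.
Context {R : realType}.
Local Notation C := R[i].

(* The norm of [R[i]] is itself [R[i]]-valued. *)
Definition cabs (z : C) : R := complex.Re `|z|.

(* Only meaningful for [0 < N]. *)
Definition ntr N (X : 'M[C]_N) : C := N%:R^-1 * \tr X.

Definition l2norm N (v : 'cV[C]_N) : R :=
  Num.sqrt (\sum_i cabs (v i 0) ^+ 2).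

Definition opnorm N (A : 'M[C]_N) : R :=
  sup [set l2norm (A *m v) | v in [set v : 'cV[C]_N | l2norm v <= 1]].

Definition mxIm N (X : 'M[C]_N) : 'M[C]_N := (2 * 'i)^-1 *: (X - X ^t*).

(* In [R[i]], [0 < x] also says that [x] is real. *)
Definition posdefmx N (A : 'M[C]_N) : Prop :=
  forall v : 'cV[C]_N, v != 0 -> 0 < (v ^t* *m A *m v) 0 0.

Definition MDE_solution N (D : 'M[C]_N) (z : C) (M : 'M[C]_N) : Prop :=
  [/\ M \in unitmx,
      - invmx M = z%:M - D + (ntr M)%:M
    & posdefmx ((complex.Im z)%:C *: mxIm M)].

(* [M^D(z)]: for Hermitian [D] and non-real [z] there is exactly one solution
   and [xget] selects it; the value is irrelevant for other arguments. *)
Definition MDE N (D : 'M[C]_N) (z : C) : 'M[C]_N :=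
  xget 0 [set M | MDE_solution D z M].

Definition rho N (D : 'M[C]_N) (z : C) : R :=
  pi^-1 * complex.Re (ntr (mxIm (MDE D z))).

Definition beta N (D1 D2 : 'M[C]_N) (z1 z2 : C) : R :=
  cabs (1 - ntr (MDE D1 z1 *m MDE D2 z2)).

Definition beta_star N (D1 D2 : 'M[C]_N) (z1 z2 : C) : R :=
  Num.min (beta D1 D2 z1 z2) (beta D1 D2 z1 z2^*).

(* [|w - a / b| /\ 1]. In [LT] below, [b = 0] forces [a != 0] (multiply the
   difference of the two equations by [M_1] and [M_2] and take traces), so the
   quotient is infinite there and the truncation is [1]. *)
Definition trunc_dist (w a b : C) : R :=
  if b == 0 then 1 else Num.min (cabs (w - a / b)) 1.

(* Only used for non-real [z1], [z2], so that the second branch is the case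
   [0 < Im z1 * Im z2]. *)
Definition LT N (D1 D2 : 'M[C]_N) (z1 z2 : C) : R :=
  let M1 := MDE D1 z1 in
  let M2 := MDE D2 z2 in
  if complex.Im z1 * complex.Im z2 < 0 then
    trunc_dist (z1 - z2) (ntr (M1 *m (D1 - D2) *m M2)) (ntr (M1 *m M2))
  else
    trunc_dist (z1 - z2^*) (ntr (M1 *m (D1 - D2) *m M2 ^t*))
      (ntr (M1 *m M2 ^t*)).

Definition gamma_hat N (D1 D2 : 'M[C]_N) (z1 z2 : C) : R :=
  complex.Re (ntr ((D1 - D2) *m (D1 - D2)))
  + LT D1 D2 z1 z2
  + Num.min (`|complex.Re z1 - complex.Re z2| ^+ 2) 1
  + Num.min (complex.Im z1 / rho D1 z1) 1
  + Num.min (complex.Im z2 / rho D2 z2) 1.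

Definition admissible (L : R) N (D : 'M[C]_N) : Prop :=
  [/\ D \is hermsymmx, ntr D = 0 & opnorm D <= L].

(* [sup_{Re z in I} ||M^D(z)|| <= C0], the supremum being over non-real [z]. *)
Definition MDE_bounded (C0 : R) N (D : 'M[C]_N) (I : interval R) : Prop :=
  forall z : C, complex.Re z \in I -> complex.Im z != 0 ->
    opnorm (MDE D z) <= C0.

End MatrixNotions.

(* Main.v *)
Require Import Defs.
From mathcomp Require Import all_boot all_order all_algebra.
From mathcomp Require Import sesquilinear spectral.
From mathcomp Require Import complex.
From mathcomp Require Import all_classical all_reals all_analysis.
From mathcomp Require Import ring lra.

Set Implicit Arguments.
Unset Strict Implicit.
Unset Printing Implicit Defensive.

Import Order.TTheory GRing.Theory Num.Theory.
Local Open Scope classical_set_scope.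
Local Open Scope ring_scope.
Local Open Scope sesquilinear_scope.

(**
  Write [m] for the normalised trace [<M>] and [w = z + m], so that a solution
  of the Dyson equation is the resolvent [M = (D - w)^-1] of a Hermitian
  matrix.  The whole proof lives in the Hilbert-Schmidt norm
  [hs X = <X X'>^(1/2)], primes denoting adjoints, for which [<X Y>] obeys the
  Cauchy-Schwarz inequality.  Taking imaginary parts in the equation gives
  [1 - hs M ^ 2 = |Im z| / (|Im z| + |Im m|)], which lies between 0 and 1.

  The key identity is
  [2 Re (1 - <M1 M2>) = (1 - hs M1 ^ 2) + (1 - hs M2 ^ 2) + hs (M1 - M2') ^ 2].
  All three terms are nonnegative, so each is at most twice
  [beta = |1 - <M1 M2>|] ([defects_le_beta]), for spectral parameters on either
  side of the real axis.  As [<M1 - M2'> = m1 - conj m2] has imaginary part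
  [Im m1 + Im m2], the last term controls [(rho1 + rho2) ^ 2] in the upper
  half plane.

  Lower bound on [beta].  The first two terms are, up to constants, the
  quantities [eta / rho] truncated at 1.  Conjugating the third by the
  inverses, [(D1 - w1) (M1 - M2') (D2 - conj w2) = (w1 - conj w2) - (D1 - D2)],
  where the traceless [D1 - D2] is orthogonal to the scalar; hence [beta]
  dominates [<(D1 - D2) ^ 2> + |w1 - conj w2| ^ 2] whenever the [w] are
  bounded ([hs2_sub_shift_le]).  They are bounded unless some [hs M ^ 2] is
  below 1/2, in which case [beta] is at least 1/4 while [gamma_hat] is bounded
  ([stability_dichotomy]).  Using [E1 - E2 = Re (w1 - w2) - Re (m1 - m2)] this
  also bounds the distance of the energies.  The remaining term of [gamma_hat]
  comes from subtracting the two equations, which yields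
  [(m1 - conj m2) (1 - <M1 M2'>)
     = (z1 - conj z2) <M1 M2'> - <M1 (D1 - D2) M2'>],
  so that the quantity [LT] is essentially
  [|m1 - conj m2| beta (z1, conj z2)].  This is trivially at most a multiple of
  [beta (z1, conj z2)]; it is also at most a multiple of [beta (z1, z2)],
  because both factors are at most of the order of the square root of
  [beta (z1, z2)]; for the second one this uses the operator norm bound on [M2]
  ([beta_conj_sqr_le]).

  Upper bound on [beta].  Put [g = gamma_hat]; only [g < 1] matters.  Since the
  product [|m1 - conj m2| beta (z1, conj z2)] is at most [g], one of its
  factors is at most [sqrt g].  The case of the second factor is immediate.  If
  the first one is small, then [w1 - conj w2] and [D1 - D2] are at most of the
  order of [sqrt g], hence so is [M1 - M2'] by the operator norm bounds on [M1]
  and [M2]; therefore [<M1 M2>] is close to [hs M1 ^ 2], which is close to 1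
  ([beta_star_le_sqrt]).  This even gives the power 1/2 of [g < 1], which is at
  most its power 1/4.

  If the equation at [z] had no solution, [MDE] would be 0, and then both
  [beta] and [LT] would be equal to 1, which makes the bounds immediate.  What
  the argument does use is uniqueness, which identifies [M (conj z)] with
  [M (z)'].
*)

(** * The real-valued modulus *)

Section Modulus.
Context {R : realType}.
Implicit Types x y : R[i].

Lemma le_of_sqr_le (a b : R) : 0 <= b -> a ^+ 2 <= b ^+ 2 -> a <= b.
Proof.
by move=> b0 ab; rewrite (le_trans (ler_norm a)) // -ler_sqr ?nnegrE //
  real_normK ?num_real.
Qed.

Lemma cabsE x : (cabs x)%:C%C = `|x|.
Proof. by rewrite /cabs normc_def. Qed.

Lemma cabs_ge0 x : 0 <= cabs x.
Proof. by rewrite -lecR cabsE normr_ge0. Qed.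

Lemma cabsM x y : cabs (x * y) = cabs x * cabs y.
Proof. by apply: (@complexI R); rewrite rmorphM /= !cabsE normrM. Qed.

Lemma cabsD x y : cabs (x + y) <= cabs x + cabs y.
Proof. by rewrite -lecR rmorphD /= !cabsE ler_normD. Qed.

Lemma cabsN x : cabs (- x) = cabs x.
Proof. by rewrite /cabs normrN. Qed.

Lemma cabsB x y : cabs (x - y) <= cabs x + cabs y.
Proof. by rewrite (le_trans (cabsD _ _)) ?cabsN. Qed.

Lemma cabs_conj x : cabs (x^*)%C = cabs x.
Proof. by rewrite /cabs normcJ. Qed.

Lemma cabs_real (a : R) : cabs a%:C%C = `|a|.
Proof. by apply: (@complexI R);
  rewrite cabsE normc_def /= expr0n addr0 sqrtr_sqr. Qed.

Lemma cabs1 : cabs (1 : R[i]) = 1.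
Proof. by rewrite (cabs_real 1) normr1. Qed.

Lemma cabs_eq0 x : (cabs x == 0) = (x == 0).
Proof. by rewrite -(inj_eq (@complexI R)) cabsE normr_eq0. Qed.

Lemma cabs_sqr x : cabs x ^+ 2 = complex.Re x ^+ 2 + complex.Im x ^+ 2.
Proof. by rewrite /cabs normc_def sqr_sqrtr // addr_ge0 ?sqr_ge0. Qed.

Lemma Re_le_cabs x : `|complex.Re x| <= cabs x.
Proof. by rewrite /cabs normc_def /= -sqrtr_sqr ler_wsqrtr // lerDl sqr_ge0.
  Qed.

Lemma Im_le_cabs x : `|complex.Im x| <= cabs x.
Proof. by rewrite /cabs normc_def /= -sqrtr_sqr ler_wsqrtr // lerDr sqr_ge0.
  Qed.

Lemma cReD x y : complex.Re (x + y) = complex.Re x + complex.Re y.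
Proof. by case: x => a b; case: y. Qed.

Lemma cImD x y : complex.Im (x + y) = complex.Im x + complex.Im y.
Proof. by case: x => a b; case: y. Qed.

Lemma cReN x : complex.Re (- x) = - complex.Re x.
Proof. by case: x. Qed.

Lemma cImN x : complex.Im (- x) = - complex.Im x.
Proof. by case: x. Qed.

Lemma cReJ x : complex.Re (x^*)%C = complex.Re x.
Proof. by case: x. Qed.

Lemma cImJ x : complex.Im (x^*)%C = - complex.Im x.
Proof. by case: x. Qed.

Lemma mulc_conj x : x * (x^*)%C = (cabs x ^+ 2)%:C%C.
Proof. by rewrite rmorphXn /= cabsE sqr_normc. Qed.

Lemma cReZ (a : R) x : complex.Re (a%:C%C * x) = a * complex.Re x.
Proof. by case: x => b c /=; rewrite mul0r subr0. Qed.

Lemma cImZ (a : R) x : complex.Im (a%:C%C * x) = a * complex.Im x.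
Proof. by case: x => b c /=; rewrite mul0r addr0. Qed.

Lemma Im_le_cabs_conj x y :
  complex.Im x + complex.Im y <= cabs (x - (y^*)%C).
Proof.
by rewrite (le_trans _ (Im_le_cabs _)) // cImD cImN cImJ opprK ler_norm.
Qed.

End Modulus.

(** * The normalised trace and the Hilbert-Schmidt norm *)

Section HilbertSchmidt.
Context {R : realType}.
Local Notation C := R[i].

Lemma trmxC_mul m n p (A : 'M[C]_(m, n)) (B : 'M[C]_(n, p)) :
  (A *m B)^t* = B^t* *m A^t*.
Proof. by rewrite trmx_mul map_mxM. Qed.

Lemma trmxCD m n (A B : 'M[C]_(m, n)) : (A + B)^t* = A^t* + B^t*.
Proof. by rewrite linearD /= map_mxD. Qed.

Lemma trmxCN m n (A : 'M[C]_(m, n)) : (- A)^t* = - A^t*.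
Proof. by rewrite linearN /= map_mxN. Qed.

Lemma trmxC_scalar n (c : C) : (c%:M : 'M[C]_n)^t* = (c^*)%C%:M.
Proof. by rewrite tr_scalar_mx map_scalar_mx. Qed.

Lemma trmxCZ m n (c : C) (A : 'M[C]_(m, n)) : (c *: A)^t* = (c^*)%C *: A^t*.
Proof. by rewrite linearZ /= map_mxZ. Qed.

Lemma hermitian_trmxC n (A : 'M[C]_n) : A \is hermsymmx -> A^t* = A.
Proof. by move=> hA; rewrite (trmx_hermitian (HermitianMx hA)) scale1r
  map_mxCK. Qed.

Section NormalisedTrace.
Variable N : nat.
Implicit Types A B X : 'M[C]_N.

Lemma ntr0 : ntr (0 : 'M[C]_N) = 0.
Proof. by rewrite /ntr mxtrace0 mulr0. Qed.

Lemma ntrD A B : ntr (A + B) = ntr A + ntr B.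
Proof. by rewrite /ntr mxtraceD mulrDr. Qed.

Lemma ntrN A : ntr (- A) = - ntr A.
Proof. by rewrite /ntr linearN /= mulrN. Qed.

Lemma ntrB A B : ntr (A - B) = ntr A - ntr B.
Proof. by rewrite ntrD ntrN. Qed.

Lemma ntrZ c A : ntr (c *: A) = c * ntr A.
Proof. by rewrite /ntr mxtraceZ mulrCA. Qed.

Lemma ntrC A B : ntr (A *m B) = ntr (B *m A).
Proof. by rewrite /ntr mxtrace_mulC. Qed.

Lemma ntr_trmxC A : ntr (A^t*) = ((ntr A)^*)%C.
Proof.
rewrite /ntr trace_map_mx mxtrace_tr rmorphM /=; congr (_ * _).
by rewrite conjc_inv conjc_nat.
Qed.

Definition hs2 A : R := complex.Re (ntr (A *m A^t*)).

Definition hs A : R := Num.sqrt (hs2 A).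

Lemma ntr_mulC_conj A B : ntr (B *m A^t*) = ((ntr (A *m B^t*))^*)%C.
Proof. by rewrite -ntr_trmxC trmxC_mul trmxCK. Qed.

Lemma ntr_hs2 A : ntr (A *m A^t*) = (hs2 A)%:C%C.
Proof.
have /eqP := ntr_mulC_conj A A; rewrite /hs2.
by case: (ntr _) => a b; rewrite eq_complex /= eqxx /= => /eqP b0; apply/eqP;
  rewrite eq_complex /= eqxx /=; apply/eqP; lra.
Qed.

Lemma hs2E A : hs2 A = N%:R^-1 * \sum_i \sum_j cabs (A i j) ^+ 2.
Proof.
apply: (@complexI R); rewrite -ntr_hs2 /ntr rmorphM fmorphV /= rmorph_nat.
congr (_ * _); rewrite rmorph_sum; apply: eq_bigr => i _.
rewrite mxE rmorph_sum; apply: eq_bigr => j _.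
by rewrite !mxE; exact: (mulc_conj (A i j)).
Qed.

Lemma hs2_ge0 A : 0 <= hs2 A.
Proof.
rewrite hs2E mulr_ge0 ?invr_ge0 ?ler0n// sumr_ge0 // => i _.
by rewrite sumr_ge0 // => j _; rewrite sqr_ge0.
Qed.

Lemma hs20 : hs2 (0 : 'M[C]_N) = 0.
Proof. by rewrite /hs2 mul0mx ntr0. Qed.

Lemma hs_ge0 A : 0 <= hs A.
Proof. exact: sqrtr_ge0. Qed.

Lemma hs_sqr A : hs A ^+ 2 = hs2 A.
Proof. by rewrite sqr_sqrtr // hs2_ge0. Qed.

Lemma hs2_trmxC A : hs2 (A^t*) = hs2 A.
Proof. by rewrite /hs2 trmxCK ntrC. Qed.

Lemma hs_trmxC A : hs (A^t*) = hs A.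
Proof. by rewrite /hs hs2_trmxC. Qed.

Lemma hs2N A : hs2 (- A) = hs2 A.
Proof. by rewrite /hs2 trmxCN mulmxN mulNmx opprK. Qed.

Lemma hsN A : hs (- A) = hs A.
Proof. by rewrite /hs hs2N. Qed.

Lemma hs2Z c A : hs2 (c *: A) = cabs c ^+ 2 * hs2 A.
Proof.
rewrite /hs2 trmxCZ -scalemxAl -scalemxAr scalerA mulc_conj ntrZ ntr_hs2.
by rewrite cReZ.
Qed.

Lemma hsZ c A : hs (c *: A) = cabs c * hs A.
Proof. by rewrite /hs hs2Z sqrtrM ?sqr_ge0 // sqrtr_sqr ger0_norm ?cabs_ge0.
  Qed.

Lemma hs2D A B :
  hs2 (A + B) = hs2 A + hs2 B + 2 * complex.Re (ntr (A *m B^t*)).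
Proof.
rewrite /hs2 trmxCD mulmxDl !mulmxDr !ntrD (ntr_mulC_conj A B) !cReD cReJ.
by rewrite [X in _ + _ + X]addrC addrACA mulr_natl mulr2n.
Qed.

Lemma hs2B A B :
  hs2 (A - B) = hs2 A + hs2 B - 2 * complex.Re (ntr (A *m B^t*)).
Proof. by rewrite hs2D hs2N trmxCN mulmxN ntrN cReN mulrN. Qed.

Lemma hs2_eq0 A : (0 < N)%N -> hs2 A = 0 -> A = 0.
Proof.
move=> N0 /eqP; rewrite hs2E mulf_eq0 invr_eq0 pnatr_eq0 gtn_eqF //=.
rewrite psumr_eq0 => [/allP A0|i _]; last first.
  by rewrite sumr_ge0 // => j _; rewrite sqr_ge0.
apply/matrixP => i j; apply/eqP; rewrite mxE -cabs_eq0.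
have := A0 i (mem_index_enum _); rewrite psumr_eq0 => [/allP/(_ j)|k _].
  by rewrite mem_index_enum => /(_ isT); rewrite sqrf_eq0.
by rewrite sqr_ge0.
Qed.

Hypothesis N_gt0 : (0 < N)%N.

Lemma ntr1 : ntr (1%:M : 'M[C]_N) = 1.
Proof. by rewrite /ntr mxtrace1 mulVf // pnatr_eq0 -lt0n. Qed.

Lemma hs1 : hs (1%:M : 'M[C]_N) = 1.
Proof. by rewrite /hs /hs2 trmxC_scalar conjc1 mulmx1 ntr1 sqrtr1. Qed.

Lemma hs_scalar (c : C) : hs (c%:M : 'M[C]_N) = cabs c.
Proof. by rewrite -scalemx1 hsZ hs1 mulr1. Qed.

(** The nonnegative quantity is the squared norm of
    [A] scaled by [hs2 B] minus [B] scaled by [<A, B>]. *)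
Lemma cauchy_schwarz_ntr A B : cabs (ntr (A *m B^t*)) <= hs A * hs B.
Proof.
apply: le_of_sqr_le; first by rewrite mulr_ge0 ?hs_ge0.
rewrite exprMn (hs_sqr A) (hs_sqr B).
have [B0|B0] := eqVneq (hs2 B) 0.
  rewrite (hs2_eq0 N_gt0 B0) trmx0 map_mx0 mulmx0 /ntr mxtrace0 mulr0.
  by rewrite (cabs_real 0) normr0 expr0n mulr_ge0 ?hs2_ge0.
have {B0} B_gt0 : 0 < hs2 B by rewrite lt_def B0 hs2_ge0.
set c := ntr _; have := hs2_ge0 ((hs2 B)%:C%C *: A - c *: B).
rewrite hs2B !hs2Z trmxCZ -scalemxAl -scalemxAr scalerA ntrZ -mulrA.
rewrite [(c^*)%C * _]mulrC mulc_conj cReZ cabs_real (ger0_norm (hs2_ge0 _)) /=.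
by rewrite -[_ <= hs2 A * _]subr_ge0 -(pmulr_rge0 _ B_gt0); lra.
Qed.

Lemma cabs_ntr_le_hs A : cabs (ntr A) <= hs A.
Proof.
have := cauchy_schwarz_ntr A 1%:M.
by rewrite trmxC_scalar conjc1 mulmx1 hs1 mulr1.
Qed.

Lemma hsD A B : hs (A + B) <= hs A + hs B.
Proof.
apply: le_of_sqr_le; first by rewrite addr_ge0 ?hs_ge0.
rewrite sqrrD (hs_sqr A) (hs_sqr B) hs_sqr hs2D.
rewrite [leRHS]addrAC lerD2l mulr_natl lerMn2r /=.
apply: le_trans (cauchy_schwarz_ntr A B).
exact: le_trans (ler_norm _) (Re_le_cabs _).
Qed.

Lemma hsB A B : hs (A - B) <= hs A + hs B.
Proof. by rewrite (le_trans (hsD _ _)) ?hsN. Qed.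

(** A traceless Hermitian matrix is orthogonal to the scalar ones. *)
Lemma hs2_scalarB c A : ntr A = 0 -> A^t* = A ->
  hs2 (c%:M - A) = cabs c ^+ 2 + hs2 A.
Proof.
move=> A0 hA; rewrite hs2B hA mul_scalar_mx ntrZ A0 mulr0 -hs_sqr hs_scalar.
by rewrite mulr0 subr0.
Qed.

End NormalisedTrace.

(** * The operator norm *)

Section OperatorNorm.
Variable N : nat.
Implicit Types (A X : 'M[C]_N) (v : 'cV[C]_N).

Lemma l2norm_ge0 v : 0 <= l2norm v.
Proof. exact: sqrtr_ge0. Qed.

Lemma l2norm_sqr v : l2norm v ^+ 2 = \sum_i cabs (v i 0) ^+ 2.
Proof. by rewrite sqr_sqrtr // sumr_ge0 // => i _; rewrite sqr_ge0. Qed.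

Lemma l2normZ c v : l2norm (c *: v) = cabs c * l2norm v.
Proof.
rewrite /l2norm; under eq_bigr do rewrite mxE cabsM exprMn.
by rewrite -mulr_sumr sqrtrM ?sqr_ge0 // sqrtr_sqr ger0_norm ?cabs_ge0.
Qed.

Lemma cabs_le_l2norm v i : cabs (v i 0) <= l2norm v.
Proof.
rewrite -ler_sqr ?nnegrE ?cabs_ge0 ?l2norm_ge0 // l2norm_sqr (bigD1 i) //=.
by rewrite lerDl sumr_ge0 // => j _; rewrite sqr_ge0.
Qed.

Lemma cabs_sum I (r : seq I) (P : pred I) (F : I -> C) :
  cabs (\sum_(i <- r | P i) F i) <= \sum_(i <- r | P i) cabs (F i).
Proof.
rewrite -lecR cabsE rmorph_sum /=; under [leRHS]eq_bigr do rewrite cabsE.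
exact: ler_norm_sum.
Qed.

Lemma l2norm_image_has_sup A :
  has_sup [set l2norm (A *m v) | v in [set v : 'cV[C]_N | l2norm v <= 1]].
Proof.
split.
  exists (l2norm (A *m 0)), 0 => //=.
  by rewrite -(scale0r 0) l2normZ (cabs_real 0) normr0 mul0r ler01.
exists (Num.sqrt (\sum_i (\sum_j cabs (A i j)) ^+ 2)) => _ [v /= v1 <-].
rewrite ler_wsqrtr // ler_sum // => i _.
rewrite ler_sqr ?nnegrE ?cabs_ge0 ?sumr_ge0 // => [|j _]; last exact: cabs_ge0.
rewrite mxE (le_trans (cabs_sum _ _ _)) // ler_sum // => j _.
by rewrite cabsM ler_piMr ?cabs_ge0 // (le_trans (cabs_le_l2norm _ _)).
Qed.

Lemma opnorm_ge0 A : 0 <= opnorm A.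
Proof.
apply: (le_trans (l2norm_ge0 (A *m 0)));
  apply: (sup_upper_bound (l2norm_image_has_sup A)).
exists 0 => //=.
by rewrite -(scale0r 0) l2normZ (cabs_real 0) normr0 mul0r ler01.
Qed.

Lemma l2norm_mulmx A v : l2norm (A *m v) <= opnorm A * l2norm v.
Proof.
have [v0|v_neq0] := eqVneq (l2norm v) 0.
  have -> : v = 0.
    apply/colP => i; apply/eqP; rewrite mxE -cabs_eq0 eq_le cabs_ge0 andbT.
    by rewrite -v0 cabs_le_l2norm.
  by rewrite mulmx0 -(scale0r 0) l2normZ (cabs_real 0) normr0 !mul0r mulr0.
have v_gt0 : 0 < l2norm v by rewrite lt_def v_neq0 l2norm_ge0.
rewrite -ler_pdivrMr // mulrC -(ger0_norm (l2norm_ge0 v)) -normfV -cabs_real.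
rewrite -l2normZ scalemxAr.
apply: (sup_upper_bound (l2norm_image_has_sup A)).
eexists; last by [].
by rewrite /= l2normZ cabs_real normfV ger0_norm ?l2norm_ge0 // mulVf.
Qed.

Lemma hs2_l2norm A : hs2 A = N%:R^-1 * \sum_j l2norm (col j A) ^+ 2.
Proof.
rewrite hs2E exchange_big /=; congr (_ * _); apply: eq_bigr => j _.
by rewrite l2norm_sqr; apply: eq_bigr => i _; rewrite mxE.
Qed.

(** The squared Hilbert-Schmidt norm is a sum over columns. *)
Lemma hs_mulmxl A X : hs (A *m X) <= opnorm A * hs X.
Proof.
apply: le_of_sqr_le; first by rewrite mulr_ge0 ?hs_ge0 ?opnorm_ge0.
rewrite exprMn (hs_sqr (A *m X)) (hs_sqr X).
rewrite !hs2_l2norm mulrCA ler_wpM2l ?invr_ge0 ?ler0n // mulr_sumr.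
apply: ler_sum => j _; rewrite (_ : col j _ = A *m col j X);
  last by rewrite !colE mulmxA.
rewrite -exprMn.
by rewrite ler_sqr ?nnegrE ?mulr_ge0 ?l2norm_ge0 ?opnorm_ge0 // l2norm_mulmx.
Qed.

Lemma hs_mulmxr A X : hs (X *m A) <= opnorm (A^t*) * hs X.
Proof. by rewrite -hs_trmxC trmxC_mul -(hs_trmxC X) hs_mulmxl. Qed.

End OperatorNorm.
End HilbertSchmidt.

(** * Solutions of the Dyson equation *)

Section DysonEquation.
Context {R : realType}.
Local Notation C := R[i].
Variable N : nat.
Hypothesis N_gt0 : (0 < N)%N.
Implicit Types (D M : 'M[C]_N) (z : C).

(** With [w = z + ntr M] the equation says [M = (D - w)^-1]. *)
Lemma MDE_solution_resolvent D z M : MDE_solution D z M ->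
  (D - (z + ntr M)%:M) *m M = 1%:M /\ M *m (D - (z + ntr M)%:M) = 1%:M.
Proof.
move=> [uM eM _]; suff -> : D - (z + ntr M)%:M = invmx M.
  by rewrite mulVmx ?mulmxV.
by rewrite -[RHS]opprK eM raddfD /= addrAC opprB.
Qed.

Lemma resolvent_identity (A1 A2 M1 M2 : 'M[C]_N) :
  M1 *m A1 = 1%:M -> A2 *m M2 = 1%:M -> M1 - M2 = M1 *m (A2 - A1) *m M2.
Proof.
by move=> e1 e2; rewrite mulmxBr mulmxBl e1 mul1mx -mulmxA e2 mulmx1.
Qed.

Lemma ntr_mxIm M : ntr (mxIm M) = (complex.Im (ntr M))%:C%C.
Proof.
rewrite /mxIm ntrZ ntrB ntr_trmxC subcJ complexiE [2%:R * _ * _]mulrAC.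
by rewrite mulKf // mulf_neq0 ?neq0Ci ?pnatr_eq0.
Qed.

Lemma ntr_posdefmx_gt0 M : posdefmx M -> 0 < ntr M.
Proof.
move=> pM; rewrite /ntr mulr_gt0 ?invr_gt0 ?ltr0n // /mxtrace.
have Mii i : 0 < M i i.
  have /pM : delta_mx i 0 != 0 :> 'cV[C]_N.
    by apply/eqP => /matrixP/(_ i 0)/eqP; rewrite !mxE !eqxx oner_eq0.
  by rewrite trmx_delta map_delta_mx -rowE -colE !mxE.
rewrite (bigD1 (Ordinal N_gt0)) //= ltr_pwDl //.
by rewrite sumr_ge0 // => i _; exact: ltW.
Qed.

Lemma MDE_solution_Im_gt0 D z M :
  MDE_solution D z M -> 0 < complex.Im z * complex.Im (ntr M).
Proof.
by move=> [_ _ /ntr_posdefmx_gt0]; rewrite ntrZ ntr_mxIm -rmorphM /= ltcR.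
Qed.

Lemma sub_shifts D1 D2 (v w : C) :
  (D2 - w%:M) - (D1 - v%:M) = (v - w)%:M - (D1 - D2).
Proof.
rewrite (raddfB (@scalar_mx _ N)) /= !opprB addrC addrACA [RHS]addrACA.
by rewrite [- D1 - _]addrC.
Qed.

Lemma sub_shift_same D (v w : C) : (D - v%:M) - (D - w%:M) = (w - v)%:M.
Proof. by rewrite opprB addrC addrA subrK raddfB. Qed.

Lemma hermitian_shift_trmxC D w :
  D^t* = D -> (D - w%:M)^t* = D - ((w^*)%C)%:M.
Proof. by move=> hD; rewrite trmxCD trmxCN hD trmxC_scalar. Qed.

Lemma MDE_solution_sub_trmxC D z M : D^t* = D -> MDE_solution D z M ->
  M - M^t* = ((z + ntr M) - ((z + ntr M)^*)%C) *: (M *m M^t*).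
Proof.
move=> hD /MDE_solution_resolvent [lM rM].
have lM' : (D - (((z + ntr M)^*)%C)%:M) *m M^t* = 1%:M.
  by rewrite -hermitian_shift_trmxC // -trmxC_mul rM trmxC_scalar conjc1.
rewrite (resolvent_identity rM lM') sub_shift_same.
by rewrite mul_mx_scalar -scalemxAl.
Qed.

(** The trace of [M - M' = (w - conj w) M M'], up to the factor [2i]. *)
Lemma MDE_solution_hs2 D z M : D^t* = D -> MDE_solution D z M ->
  (complex.Im z + complex.Im (ntr M)) * hs2 M = complex.Im (ntr M).
Proof.
move=> hD sM; have /(congr1 (fun X => complex.Im (ntr X))) :=
  MDE_solution_sub_trmxC hD sM.
rewrite ntrB ntr_trmxC ntrZ ntr_hs2 [_ * (hs2 M)%:C%C]mulrC cImZ !cImD !cImN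
  !cImJ !cImD.
by rewrite !opprK; lra.
Qed.

(** In the form with absolute values the formula holds on both sides of the
    real axis, as [Im z] and [Im (ntr M)] have the same sign. *)
Lemma MDE_solution_one_sub_hs2 D z M : D^t* = D -> MDE_solution D z M ->
  1 - hs2 M = `|complex.Im z| / (`|complex.Im z| + `|complex.Im (ntr M)|).
Proof.
move=> hD sM; have := MDE_solution_hs2 hD sM.
have := MDE_solution_Im_gt0 sM;
  move: (complex.Im z) (complex.Im (ntr M)) => a b.
have [a0|a0|->] := ltrgtP a 0; last by rewrite mul0r ltxx.
  rewrite nmulr_rgt0 // => b0 e; rewrite !ltr0_norm //.
  have ab : a + b != 0 by apply/eqP; lra.
  have -> : hs2 M = b / (a + b) by rewrite -[X in X / _]e mulrC mulKf.
  by field; apply/andP; split; apply/eqP; lra.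
rewrite pmulr_rgt0 // => b0 e; rewrite !gtr0_norm //.
have ab : a + b != 0 by apply/eqP; lra.
have -> : hs2 M = b / (a + b) by rewrite -[X in X / _]e mulrC mulKf.
by field.
Qed.

Lemma MDE_solution_hs_lt1 D z M :
  D^t* = D -> MDE_solution D z M -> hs M < 1.
Proof.
move=> hD sM; have := MDE_solution_one_sub_hs2 hD sM.
have := MDE_solution_Im_gt0 sM.
set a := complex.Im z; set b := complex.Im _ => ab e.
have : 0 < 1 - hs2 M.
  rewrite e divr_gt0 // ?ltr_pwDl // normr_gt0.
    by apply: contraTneq ab => ->; rewrite mul0r ltxx.
  by apply: contraTneq ab => ->; rewrite mul0r ltxx.
by rewrite -hs_sqr subr_gt0 -[ltRHS](expr1n _ 2) ltr_sqr ?nnegrE ?hs_ge0.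
Qed.

(** Subtracting the resolvents gives [m - m' = (m - m') <M M'>], where
    [<M M'>] has modulus less than one by Cauchy-Schwarz. *)
Lemma MDE_solution_unique D z M M' : D^t* = D ->
  MDE_solution D z M -> MDE_solution D z M' -> M = M'.
Proof.
move=> hD s s'; have [l r] := MDE_solution_resolvent s.
have [l' r'] := MDE_solution_resolvent s'.
have e : M - M' = (ntr M - ntr M') *: (M *m M').
  rewrite (resolvent_identity r l') opprB addrAC addrCA subrr addr0 -raddfB /=.
  by rewrite mul_mx_scalar -scalemxAl opprD addrACA subrr add0r.
suff m0 : ntr M - ntr M' = 0.
  by apply/eqP; rewrite -subr_eq0 e m0 scale0r.
apply/eqP; rewrite -cabs_eq0; apply/negPn/negP => ne.
have : cabs (ntr M - ntr M') = cabs (ntr M - ntr M') * cabs (ntr (M *m M')).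
  by rewrite -cabsM -ntrZ -e ntrB.
rewrite -[LHS]mulr1 => /(mulfI ne)/esym h.
have := cauchy_schwarz_ntr N_gt0 M (M'^t*); rewrite trmxCK h hs_trmxC.
apply/negP; rewrite -ltNge.
by rewrite mulr_ilt1 ?hs_ge0 ?(MDE_solution_hs_lt1 hD s) ?(MDE_solution_hs_lt1
  hD s').
Qed.

Lemma MDE_solution_trmxC D z M : D^t* = D ->
  MDE_solution D z M -> MDE_solution D (z^*)%C (M^t*).
Proof.
move=> hD [uM eM pM]; split.
- by rewrite map_unitmx unitmx_tr.
- by rewrite -map_invmx -trmx_inv -trmxCN eM !trmxCD trmxCN hD !trmxC_scalar
  ntr_trmxC.
- suff -> : (complex.Im (z^*)%C)%:C%C *: mxIm (M^t*) =
            (complex.Im z)%:C%C *: mxIm M by [].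
  rewrite cImJ rmorphN /= scaleNr -scalerN; congr (_ *: _).
  by rewrite /mxIm trmxCK -scalerN opprB.
Qed.

Lemma MDE_sol_or_eq0 D z : MDE_solution D z (MDE D z) \/ MDE D z = 0.
Proof. by rewrite /MDE; case: xgetP => [M _ sM|_]; [left|right]. Qed.

(** Both sides solve the equation at the conjugate point; if there is no
    solution then both are the default value 0. *)
Lemma MDE_conj D z : D^t* = D -> MDE D (z^*)%C = (MDE D z)^t*.
Proof.
move=> hD; case: (MDE_sol_or_eq0 D z) => [s|e].
  apply: xget_unique; first exact: MDE_solution_trmxC.
  by move=> M sM; apply: MDE_solution_unique sM (MDE_solution_trmxC hD s).
have [s'|->] := MDE_sol_or_eq0 D (z^*)%C; last by rewrite e trmx0 map_mx0.
have := MDE_solution_trmxC hD s'; rewrite conjcK => s.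
have {}s : MDE_solution D z (MDE D z) by exact: (xgetI _ s).
by have := MDE_solution_Im_gt0 s; rewrite e ntr0 /= mulr0 ltxx.
Qed.

Lemma rhoE D z : rho D z = pi^-1 * complex.Im (ntr (MDE D z)).
Proof. by rewrite /rho ntr_mxIm. Qed.

End DysonEquation.

(** * Comparing two solutions *)

Section TwoSolutions.
Context {R : realType}.
Local Notation C := R[i].
Variable N : nat.
Hypothesis N_gt0 : (0 < N)%N.

(** The identity behind every bound: [1 - Re <M1 M2>] splits into three
    quantities that are nonnegative for solutions of the Dyson equation. *)
Lemma one_sub_Re_ntr (M1 M2 : 'M[C]_N) :
  2 * complex.Re (1 - ntr (M1 *m M2)) =
  (1 - hs2 M1) + (1 - hs2 M2) + hs2 (M1 - M2^t*).
Proof.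
rewrite hs2B trmxCK hs2_trmxC cReD cReN /=.
by move: (hs2 M1) (hs2 M2) (complex.Re _) => a b c; ring.
Qed.

Lemma defects_le_beta (M1 M2 : 'M[C]_N) : hs2 M1 <= 1 -> hs2 M2 <= 1 ->
  [/\ 1 - hs2 M1 <= 2 * cabs (1 - ntr (M1 *m M2)),
      1 - hs2 M2 <= 2 * cabs (1 - ntr (M1 *m M2)) &
      hs2 (M1 - M2^t*) <= 2 * cabs (1 - ntr (M1 *m M2))].
Proof.
have := one_sub_Re_ntr M1 M2; have := hs2_ge0 (M1 - M2^t*).
have := le_trans (ler_norm _) (Re_le_cabs (1 - ntr (M1 *m M2))).
move: (complex.Re _) (cabs _) (hs2 M1) (hs2 M2) (hs2 _) => r c a1 a2 d.
by move=> h1 h2 h3 h4 h5; split; lra.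
Qed.

Lemma cabs_ntr_sub_conj_sqr (M1 M2 : 'M[C]_N) : hs2 M1 <= 1 -> hs2 M2 <= 1 ->
  cabs (ntr M1 - ((ntr M2)^*)%C) ^+ 2 <= 2 * cabs (1 - ntr (M1 *m M2)).
Proof.
move=> h1 h2; have [_ _] := defects_le_beta h1 h2; apply: le_trans.
rewrite -ntr_trmxC -ntrB -hs_sqr ler_sqr ?nnegrE ?cabs_ge0 ?hs_ge0 //.
exact: cabs_ntr_le_hs.
Qed.

Lemma MDE_solution_hs2_le1 (D : 'M[C]_N) z M :
  D^t* = D -> MDE_solution D z M -> hs2 M <= 1.
Proof.
move=> hD sM; rewrite -subr_ge0 (MDE_solution_one_sub_hs2 N_gt0 hD sM).
by rewrite divr_ge0 ?addr_ge0.
Qed.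

Lemma cabs_ntr_mul_le1 (M1 M2 : 'M[C]_N) :
  hs2 M1 <= 1 -> hs2 M2 <= 1 -> cabs (ntr (M1 *m M2)) <= 1.
Proof.
move=> h1 h2; have := cauchy_schwarz_ntr N_gt0 M1 (M2^t*).
rewrite trmxCK hs_trmxC => /le_trans; apply; rewrite mulr_ile1 ?hs_ge0 //.
  by rewrite -(sqrtr1 R) ler_wsqrtr.
by rewrite -(sqrtr1 R) ler_wsqrtr.
Qed.

Variables (L : R).

Lemma hs_mul_shiftl (D X : 'M[C]_N) w : opnorm D <= L ->
  hs ((D - w%:M) *m X) <= (L + cabs w) * hs X.
Proof.
move=> hD; rewrite mulmxBl mul_scalar_mx (le_trans (hsB N_gt0 _ _)) //.
rewrite hsZ mulrDl lerD2r (le_trans (hs_mulmxl _ _)) //.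
by rewrite ler_wpM2r ?hs_ge0.
Qed.

Lemma hs_mul_shiftr (D X : 'M[C]_N) w : opnorm D <= L -> D^t* = D ->
  hs (X *m (D - w%:M)) <= (L + cabs w) * hs X.
Proof.
move=> nD hD; rewrite -hs_trmxC trmxC_mul hermitian_shift_trmxC //.
by rewrite -(cabs_conj w) -(hs_trmxC X) hs_mul_shiftl.
Qed.

Lemma opnorm_hs_le (D : 'M[C]_N) : opnorm D <= L -> hs D <= L.
Proof.
move=> nD; rewrite -[D]mulmx1 (le_trans (hs_mulmxl _ _)) //.
by rewrite hs1 ?mulr1.
Qed.

(** [(D - w) M = 1] gives [|w| hs M <= L hs M + 1]. *)
Lemma cabs_shift_le (D : 'M[C]_N) z M : opnorm D <= L -> MDE_solution D z M ->
  1 / 2 <= hs2 M -> cabs (z + ntr M) <= L + 2.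
Proof.
move=> nD /MDE_solution_resolvent [+ _] hM.
rewrite mulmxBl mul_scalar_mx => /eqP; rewrite subr_eq addrC -subr_eq => /eqP e.
have : cabs (z + ntr M) * hs M <= L * hs M + 1.
  rewrite -hsZ -e (le_trans (hsB N_gt0 _ _)) // hs1 // lerD2r.
  by rewrite (le_trans (hs_mulmxl _ _)) // ler_wpM2r ?hs_ge0.
have := hs_ge0 M; move: hM; rewrite -hs_sqr.
move: (hs M) (cabs _) => h c h1 h2 h3.
have h4 : 1 / 2 <= h by nra.
nra.
Qed.

(** With primes for adjoints,
    [(D1 - w1) (M1 - M2') (D2 - w2') = (w1 - w2') - (D1 - D2)], and the two
    terms on the right are orthogonal since [D1 - D2] is traceless. Each
    inverse [D - w] has operator norm at most [L + |w| <= 2 * L + 2]. *)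
Lemma hs2_sub_shift_le (D1 D2 M1 M2 : 'M[C]_N) z1 z2 :
  D1^t* = D1 -> D2^t* = D2 -> ntr D1 = 0 -> ntr D2 = 0 ->
  opnorm D1 <= L -> opnorm D2 <= L ->
  MDE_solution D1 z1 M1 -> MDE_solution D2 z2 M2 ->
  1 / 2 <= hs2 M1 -> 1 / 2 <= hs2 M2 ->
  hs2 (D1 - D2) + cabs ((z1 + ntr M1) - ((z2 + ntr M2)^*)%C) ^+ 2 <=
  2 * (2 * L + 2) ^+ 4 * cabs (1 - ntr (M1 *m M2)).
Proof.
move=> hD1 hD2 t1 t2 n1 n2 s1 s2 h1 h2.
have w1 := cabs_shift_le n1 s1 h1; have w2 := cabs_shift_le n2 s2 h2.
have := defects_le_beta (MDE_solution_hs2_le1 hD1 s1) (MDE_solution_hs2_le1 hD2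
  s2).
case=> _ _; have [l1 _] := MDE_solution_resolvent s1.
have [l2 _] := MDE_solution_resolvent s2.
move: l1 l2 w1 w2; set v1 := z1 + _; set v2 := z2 + _ => l1 l2 w1 w2 hM.
have r2 : M2^t* *m (D2 - ((v2^*)%C)%:M) = 1%:M.
  by rewrite -hermitian_shift_trmxC // -trmxC_mul l2 trmxC_scalar conjc1.
have e : (D1 - v1%:M) *m ((M1 - M2^t*) *m (D2 - ((v2^*)%C)%:M)) =
         (v1 - (v2^*)%C)%:M - (D1 - D2).
  rewrite (mulmxBl M1) r2 mulmxBr mulmxA l1 mul1mx mulmx1.
  exact: sub_shifts.
have : hs ((v1 - (v2^*)%C)%:M - (D1 - D2)) <=
    (2 * L + 2) ^+ 2 * hs (M1 - M2^t*).
  rewrite -e (le_trans (hs_mul_shiftl _ _ n1)) // expr2 -mulrA.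
  have L0 : 0 <= L by exact: le_trans (opnorm_ge0 _) n1.
  apply: ler_pM; rewrite ?addr_ge0 ?cabs_ge0 ?hs_ge0 //; first lra.
  rewrite (le_trans (hs_mul_shiftr _ _ n2 hD2)) // cabs_conj.
  by rewrite ler_wpM2r ?hs_ge0 //; lra.
move/(lerXn2r 2); rewrite !nnegrE hs_ge0 mulr_ge0 ?sqr_ge0 ?hs_ge0 //.
move=> /(_ isT isT); rewrite exprMn hs_sqr hs_sqr hs2_scalarB //; last 2 first.
  by rewrite ntrB t1 t2 subr0.
  by rewrite trmxCD trmxCN hD1 hD2.
rewrite addrC -exprM => /le_trans; apply.
rewrite [leRHS](_ : _ = (2 * L + 2) ^+ 4 * (2 * cabs (1 - ntr (M1 *m M2)))).
  by rewrite ler_wpM2l // exprn_even_ge0.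
by rewrite mulrAC mulrC.
Qed.

End TwoSolutions.

(** * Lower bounds on the stability factor *)

(* Conversion must not unfold the choice operator inside [MDE]. *)
Local Opaque hs hs2 cabs ntr opnorm MDE.

Section StabilityEstimates.
Context {R : realType}.
Local Notation C := R[i].

(** The setting of all estimates below. It puts no condition on the signs of
    [Im z1] and [Im z2], so that it is stable under replacing [(z2, M2)] by
    its conjugate, which exchanges the two stability factors. *)
Definition dyson_pair L N (D1 D2 : 'M[C]_N) z1 z2 M1 M2 :=
  [/\ (0 < N)%N, admissible L D1, admissible L D2,
      MDE_solution D1 z1 M1 & MDE_solution D2 z2 M2].

Lemma admissible_trmxC L N (D : 'M[C]_N) : admissible L D -> D^t* = D.
Proof. by case=> /hermitian_trmxC. Qed.

Lemma dyson_pair_hs2_le1 L N (D1 D2 : 'M[C]_N) z1 z2 M1 M2 :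
  dyson_pair L D1 D2 z1 z2 M1 M2 -> hs2 M1 <= 1 /\ hs2 M2 <= 1.
Proof.
move=> [N_gt0 /admissible_trmxC a1 /admissible_trmxC a2 s1 s2].
split; first exact: (MDE_solution_hs2_le1 N_gt0 a1 s1).
exact: (MDE_solution_hs2_le1 N_gt0 a2 s2).
Qed.

Lemma hs2_sub_admissible_le L N (D1 D2 : 'M[C]_N) : (0 < N)%N ->
  admissible L D1 -> admissible L D2 -> hs2 (D1 - D2) <= 4 * L ^+ 2.
Proof.
move=> N_gt0 [_ _ n1] [_ _ n2].
have L0 : 0 <= L by exact: le_trans (opnorm_ge0 _) n1.
have h : hs (D1 - D2) <= 2 * L.
  rewrite (le_trans (hsB N_gt0 _ _)) //.
  by have := opnorm_hs_le N_gt0 n1; have := opnorm_hs_le N_gt0 n2; clear => *;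
    lra.
rewrite -hs_sqr; have := hs_ge0 (D1 - D2).
by move: h L0; move: (hs _); clear => *; nra.
Qed.

(** If one of the solutions is small then [w] may be large, but the
    stability factor is bounded below since it dominates [1 - hs2 M]. *)
Lemma stability_dichotomy L N (D1 D2 : 'M[C]_N) z1 z2 M1 M2 :
  dyson_pair L D1 D2 z1 z2 M1 M2 ->
  1 / 4 <= cabs (1 - ntr (M1 *m M2)) \/
  hs2 (D1 - D2) + cabs ((z1 + ntr M1) - ((z2 + ntr M2)^*)%C) ^+ 2 <=
    2 * (2 * L + 2) ^+ 4 * cabs (1 - ntr (M1 *m M2)).
Proof.
move=> pair; have [M1_le1 M2_le1] := dyson_pair_hs2_le1 pair.
case: pair => N_gt0 adm1 adm2 sol1 sol2.
have [D1_herm D2_herm] := (admissible_trmxC adm1, admissible_trmxC adm2).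
have [[_ t1 n1] [_ t2 n2]] := (adm1, adm2).
have [e1 e2 _] := defects_le_beta M1_le1 M2_le1.
have [h1|h1] := leP (1 / 2) (hs2 M1); last first.
  by left; move: e1 h1; clear => *; lra.
have [h2|h2] := leP (1 / 2) (hs2 M2); last first.
  by left; move: e2 h2; clear => *; lra.
by right; exact: hs2_sub_shift_le.
Qed.

(** The real part of [z1 - z2] is that of
    [(w1 - conj w2) - (ntr M1 - conj (ntr M2))]. *)
Lemma hs2_sub_add_Re_sub_sqr_le L N (D1 D2 : 'M[C]_N) z1 z2 M1 M2 :
  dyson_pair L D1 D2 z1 z2 M1 M2 ->
  hs2 (D1 - D2) + Num.min (`|complex.Re z1 - complex.Re z2| ^+ 2) 1 <=
  (16 * L ^+ 2 + 4 * (2 * L + 2) ^+ 4 + 4) * cabs (1 - ntr (M1 *m M2)).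
Proof.
move=> pair; have [M1_le1 M2_le1] := dyson_pair_hs2_le1 pair.
have := stability_dichotomy pair; case: pair => N_gt0 adm1 adm2 _ _.
have K4 : 0 <= (2 * L + 2) ^+ 4 by rewrite exprn_even_ge0.
case=> h.
  have : Num.min (`|complex.Re z1 - complex.Re z2| ^+ 2) 1 <= 1.
    by rewrite ge_min lexx orbT.
  have := hs2_sub_admissible_le N_gt0 adm1 adm2; move: h; have := sqr_ge0 L;
    move: K4.
  move: ((2 * L + 2) ^+ 4) (hs2 _) (Num.min _ _) (L ^+ 2) (cabs _) => k a b l c.
  by clear => *; nra.
have hm := cabs_ntr_sub_conj_sqr N_gt0 M1_le1 M2_le1.
have hE : `|complex.Re z1 - complex.Re z2| ^+ 2 <=
    2 * cabs ((z1 + ntr M1) - ((z2 + ntr M2)^*)%C) ^+ 2 +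
    2 * cabs (ntr M1 - ((ntr M2)^*)%C) ^+ 2.
  have h1 := Re_le_cabs ((z1 + ntr M1) - ((z2 + ntr M2)^*)%C).
  have h2 := Re_le_cabs (ntr M1 - ((ntr M2)^*)%C).
  have := ler_normB (complex.Re ((z1 + ntr M1) - ((z2 + ntr M2)^*)%C))
    (complex.Re (ntr M1 - ((ntr M2)^*)%C)).
  move: h1 h2; rewrite !cReD !cReN !cReJ !cReD.
  rewrite (_ : complex.Re z1 + _ - _ - _ = complex.Re z1 - complex.Re z2);
    last by clear => *; ring.
  move: (cabs _) (cabs _) => a b h1 h2 h3.
  have h4 : `|complex.Re z1 - complex.Re z2| <= a + b by move: h1 h2 h3;
    clear => *; lra.
  have := normr_ge0 (complex.Re z1 - complex.Re z2);
    move: (`|complex.Re z1 - _|) h4 => c h4 h5.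
  by have := sqr_ge0 (a - b); move: h4 h5; clear => *; nra.
have : Num.min (`|complex.Re z1 - complex.Re z2| ^+ 2) 1 <=
    `|complex.Re z1 - complex.Re z2| ^+ 2 by rewrite ge_min lexx.
have := hs2_ge0 (D1 - D2);
  have := mulr_ge0 (sqr_ge0 L) (cabs_ge0 (1 - ntr (M1 *m M2))).
move: h hm hE; move: (cabs (1 - _)) ((2 * L + 2) ^+ 4) (L ^+ 2).
move: (cabs _ ^+ 2) (cabs _ ^+ 2) (`|complex.Re z1 - _| ^+ 2) (hs2 _).
by clear => *; lra.
Qed.

Lemma MDE_solution_Im_ntr_gt0 N (D M : 'M[C]_N) z : (0 < N)%N ->
  MDE_solution D z M -> 0 < complex.Im z -> 0 < complex.Im (ntr M).
Proof.
by move=> N_gt0 /(MDE_solution_Im_gt0 N_gt0) + z0; rewrite pmulr_rgt0.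
Qed.

Lemma cabs_sub_conj (w : C) : cabs (w - (w^*)%C) = 2 * `|complex.Im w|.
Proof.
apply/eqP; rewrite -(eqrXn2 (n := 2)) ?cabs_ge0 ?mulr_ge0 ?normr_ge0 //.
rewrite cabs_sqr cReD cImD cReN cImN cReJ cImJ exprMn real_normK ?num_real //.
by apply/eqP; clear => *; ring.
Qed.

Lemma cabs_one_sub_le2 N (M M' : 'M[C]_N) : (0 < N)%N ->
  hs2 M <= 1 -> hs2 M' <= 1 -> cabs (1 - ntr (M *m M')) <= 2.
Proof.
move=> N_gt0 h h'; rewrite (le_trans (cabsB _ _)) // cabs1.
by have := cabs_ntr_mul_le1 N_gt0 h h'; clear => *; lra.
Qed.

(** Since [z1, z2] lie on the same side of the real axis, closeness of [w1] to
    the conjugate of [w2] forces both to be close to the real axis, so that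
    [M2] nearly coincides with its adjoint. *)
Lemma beta_conj_sqr_le C0 L N (D1 D2 : 'M[C]_N) z1 z2 M1 M2 :
  dyson_pair L D1 D2 z1 z2 M1 M2 ->
  0 < complex.Im z1 -> 0 < complex.Im z2 ->
  opnorm M2 <= C0 ->
  cabs (1 - ntr (M1 *m M2^t*)) ^+ 2 <=
  (16 + 16 * C0 ^+ 2 * (2 * L + 2) ^+ 4) * cabs (1 - ntr (M1 *m M2)).
Proof.
move=> pair z1_gt0 z2_gt0 nM2; have [M1_le1 M2_le1] := dyson_pair_hs2_le1 pair.
have := stability_dichotomy pair; case: pair => N_gt0 _ adm2 sol1 sol2.
have D2_herm := admissible_trmxC adm2.
have b2 := cabs_one_sub_le2 N_gt0 M1_le1 M2_le1.
have M2t_le1 : hs2 (M2^t*) <= 1 by rewrite hs2_trmxC.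
have b2' := cabs_one_sub_le2 N_gt0 M1_le1 M2t_le1.
have b0' := cabs_ge0 (1 - ntr (M1 *m M2^t*)).
have K4 : 0 <= C0 ^+ 2 * (2 * L + 2) ^+ 4 by rewrite mulr_ge0 ?sqr_ge0 //
  exprn_even_ge0.
case=> h.
  rewrite -mulrA; move: b2 b2' b0' h; move: (C0 ^+ 2 * _) K4 (cabs _) (cabs _).
  by clear => *; nra.
have hw : `|complex.Im (z2 + ntr M2)| <=
    cabs (z1 + ntr M1 - ((z2 + ntr M2)^*)%C).
  apply: le_trans (Im_le_cabs_conj _ _).
  have := MDE_solution_Im_ntr_gt0 N_gt0 sol1 z1_gt0.
  have := MDE_solution_Im_ntr_gt0 N_gt0 sol2 z2_gt0.
  by rewrite !cImD => ? ?; rewrite gtr0_norm; lra.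
have hs2M : hs M2 <= 1 by rewrite -(sqrtr1 R) ler_wsqrtr.
have hs1M : hs M1 <= 1 by rewrite -(sqrtr1 R) ler_wsqrtr.
have ht : cabs (1 - ntr (M1 *m M2^t*)) <=
    cabs (1 - ntr (M1 *m M2)) +
    C0 * (2 * cabs (z1 + ntr M1 - ((z2 + ntr M2)^*)%C)).
  have -> : 1 - ntr (M1 *m M2^t*) =
      1 - ntr (M1 *m M2) + ntr (M1 *m (M2 - M2^t*)).
    by rewrite mulmxBr ntrB addrA subrK.
  rewrite (le_trans (cabsD _ _)) // lerD2l.
  have := cauchy_schwarz_ntr N_gt0 M1 ((M2 - M2^t*)^t*).
  rewrite trmxCK hs_trmxC => /le_trans; apply.
  apply: (@le_trans _ _ (hs (M2 - M2^t*))); first by rewrite ler_piMl ?hs_ge0.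
  rewrite (MDE_solution_sub_trmxC D2_herm sol2) hsZ cabs_sub_conj mulrC.
  apply: ler_pM; rewrite ?hs_ge0 ?mulr_ge0 ?normr_ge0 //; last by move: hw;
    clear => *; lra.
  rewrite (le_trans (hs_mulmxl _ _)) // hs_trmxC.
  by rewrite (le_trans _ nM2) // ler_piMr ?opnorm_ge0.
have := hs2_ge0 (D1 - D2).
have b0 := cabs_ge0 (1 - ntr (M1 *m M2)).
rewrite -mulrA; move: h ht b2 b0 b0' K4.
move: (cabs (1 - ntr (M1 *m M2^t*))) (cabs (1 - ntr (M1 *m M2))) (hs2 _).
move: (cabs _) ((2 * L + 2) ^+ 4); clear => x k b b' d h1 h2 b2 b'0 b0 k0 d0.
have h3 : b ^+ 2 <= (b' + C0 * (2 * x)) ^+ 2 by nra.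
have : x ^+ 2 <= 2 * k * b' by lra.
move/(ler_wpM2l (sqr_ge0 C0)) => h4.
(* [(b' + t) ^ 2 <= 2 b' ^ 2 + 2 t ^ 2] for [t = 2 C0 x], and [b' <= 2]. *)
have := sqr_ge0 (b' - C0 * (2 * x)).
nra.
Qed.

End StabilityEstimates.

(** * The linear term *)

Section StabilityBounds.
Context {R : realType}.
Local Notation C := R[i].

Lemma trunc_dist_le1 (w a b : C) : trunc_dist w a b <= 1.
Proof. by rewrite /trunc_dist; case: ifP => // _; rewrite ge_min lexx orbT. Qed.

Lemma trunc_dist_ge0 (w a b : C) : 0 <= trunc_dist w a b.
Proof.
by rewrite /trunc_dist; case: ifP => // _; rewrite le_min cabs_ge0 ler01.
Qed.

Lemma cabs_sub_div (w a b d : C) : b != 0 -> d * (1 - b) = w * b - a ->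
  cabs (w - a / b) * cabs b = cabs d * cabs (1 - b).
Proof. by move=> b0 e; rewrite -!cabsM e mulrBl divfK. Qed.

(** Here [d] is the difference of two traces and [b] stands for [<M1 M2>].
    The difference [w - a / b] equals [d (1 - b) / b], which is harmless unless
    [b] is small; in that case [1 - b] is of order one. *)
Lemma trunc_dist_le (w a b d : C) : d * (1 - b) = w * b - a ->
  1 / 2 <= cabs (1 - b) \/ trunc_dist w a b <= 2 * (cabs d * cabs (1 - b)).
Proof.
move=> e; have [h|h] := leP (1 / 2) (cabs (1 - b)); [by left | right].
have hb : 1 / 2 <= cabs b.
  have := cabsD (1 - b) b; rewrite subrK cabs1.
  by move: h; clear => *; lra.
have b0 : b != 0 by rewrite -cabs_eq0; apply/eqP; move: hb; clear => *; lra.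
rewrite /trunc_dist (negbTE b0) -(cabs_sub_div b0 e) ge_min; apply/orP; left.
by have := cabs_ge0 (w - a / b); move: hb; clear => *; nra.
Qed.

(** When the truncation is inactive, no division remains. *)
Lemma trunc_dist_lt1 (w a b d : C) : d * (1 - b) = w * b - a -> cabs b <= 1 ->
  trunc_dist w a b < 1 -> cabs d * cabs (1 - b) <= trunc_dist w a b.
Proof.
move=> e hb; rewrite /trunc_dist; case: ifPn => [|b0]; first by rewrite ltxx.
rewrite -(cabs_sub_div b0 e) gt_min ltxx orbF => h.
by rewrite (min_idPl (ltW h)) ler_piMr ?cabs_ge0.
Qed.

(** The trace of the resolvent identity for [M1 - M2], after moving
    [(ntr M1 - ntr M2) <M1 M2>], which comes from [w1 - w2], to the left. *)
Lemma ntr_sub_mul N (D1 D2 M1 M2 : 'M[C]_N) z1 z2 :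
  MDE_solution D1 z1 M1 -> MDE_solution D2 z2 M2 ->
  (ntr M1 - ntr M2) * (1 - ntr (M1 *m M2)) =
  (z1 - z2) * ntr (M1 *m M2) - ntr (M1 *m (D1 - D2) *m M2).
Proof.
move=> /MDE_solution_resolvent [_ r1] /MDE_solution_resolvent [l2 _].
have : ntr M1 - ntr M2 = (z1 - z2 + (ntr M1 - ntr M2)) * ntr (M1 *m M2)
    - ntr (M1 *m (D1 - D2) *m M2).
  rewrite -{1}ntrB (resolvent_identity r1 l2).
  rewrite sub_shifts (_ : z1 + _ - _ = z1 - z2 + (ntr M1 - ntr M2)).
    by rewrite mulmxBr mulmxBl ntrB mul_mx_scalar -scalemxAl ntrZ.
  by rewrite opprD addrACA.
move: (ntr M1) (ntr M2) (ntr (M1 *m M2)) (ntr _) => a b c d.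
move=> e; rewrite mulrBr mulr1 {1}e mulrDl.
by rewrite addrAC addrK.
Qed.

Lemma dyson_pair_trmxC L N (D1 D2 : 'M[C]_N) z1 z2 M1 M2 :
  dyson_pair L D1 D2 z1 z2 M1 M2 ->
  dyson_pair L D1 D2 z1 (z2^*)%C M1 (M2^t*).
Proof.
case=> N_gt0 a1 a2 s1 s2.
have s2' := MDE_solution_trmxC (admissible_trmxC a2) s2.
exact: And5 N_gt0 a1 a2 s1 s2'.
Qed.

(** [LT] for two points of the upper half plane, with arbitrary solutions in
    place of the chosen ones. *)
Definition LT_of N (D1 D2 : 'M[C]_N) (z1 z2 : C) (M1 M2 : 'M[C]_N) : R :=
  trunc_dist (z1 - (z2^*)%C)
    (ntr (M1 *m (D1 - D2) *m M2^t*)) (ntr (M1 *m M2^t*)).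

Lemma ntr_sub_mul_trmxC L N (D1 D2 : 'M[C]_N) z1 z2 M1 M2 :
  dyson_pair L D1 D2 z1 z2 M1 M2 ->
  (ntr M1 - ((ntr M2)^*)%C) * (1 - ntr (M1 *m M2^t*)) =
  (z1 - (z2^*)%C) * ntr (M1 *m M2^t*) - ntr (M1 *m (D1 - D2) *m M2^t*).
Proof.
move=> /dyson_pair_trmxC [_ _ _ s1 s2].
by rewrite -(ntr_sub_mul s1 s2) ntr_trmxC.
Qed.

Lemma dyson_pair_hs_le1 L N (D1 D2 : 'M[C]_N) z1 z2 M1 M2 :
  dyson_pair L D1 D2 z1 z2 M1 M2 -> hs M1 <= 1 /\ hs M2 <= 1.
Proof.
move=> /dyson_pair_hs2_le1 [h1 h2]; rewrite -(sqrtr1 R).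
by split; apply: ler_wsqrtr.
Qed.

Lemma LT_of_le_beta_conj L N (D1 D2 : 'M[C]_N) z1 z2 M1 M2 :
  dyson_pair L D1 D2 z1 z2 M1 M2 ->
  LT_of D1 D2 z1 z2 M1 M2 <= 4 * cabs (1 - ntr (M1 *m M2^t*)).
Proof.
move=> pair; have [N_gt0 _ _ _ _] := pair.
have hd : cabs (ntr M1 - ((ntr M2)^*)%C) <= 2.
  have h1 := cabs_ntr_le_hs N_gt0 M1; have h2 := cabs_ntr_le_hs N_gt0 M2.
  have [h3 h4] := dyson_pair_hs_le1 pair.
  rewrite (le_trans (cabsB _ _)) // cabs_conj.
  by move: h1 h2 h3 h4; clear => *; lra.
have := trunc_dist_le (ntr_sub_mul_trmxC pair).
have := trunc_dist_le1 (z1 - (z2^*)%C)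
  (ntr (M1 *m (D1 - D2) *m M2^t*)) (ntr (M1 *m M2^t*)).
have := cabs_ge0 (1 - ntr (M1 *m M2^t*)); move: hd;
  rewrite -/(LT_of _ _ _ _ _ _).
move: (LT_of _ _ _ _ _ _) (cabs (1 - _)) (cabs _).
by clear => t b d hd b0 t1 [h|h]; [lra | nra].
Qed.

(** The square of [|m1 - conj m2|] and that of the conjugate stability factor
    are both bounded by the stability factor, so the arithmetic-geometric mean
    inequality handles their product. *)
Lemma LT_of_le_beta C0 L N (D1 D2 : 'M[C]_N) z1 z2 M1 M2 :
  dyson_pair L D1 D2 z1 z2 M1 M2 ->
  0 < complex.Im z1 -> 0 < complex.Im z2 -> opnorm M2 <= C0 ->
  LT_of D1 D2 z1 z2 M1 M2 <=
  (2 + 4 * (16 + 16 * C0 ^+ 2 * (2 * L + 2) ^+ 4)) * cabs (1 - ntr (M1 *m M2)).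
Proof.
move=> pair z1_gt0 z2_gt0 nM2; have [l1 l2] := dyson_pair_hs2_le1 pair.
have [N_gt0 _ _ _ _] := pair.
have := trunc_dist_le (ntr_sub_mul_trmxC pair).
have := trunc_dist_le1 (z1 - (z2^*)%C)
  (ntr (M1 *m (D1 - D2) *m M2^t*)) (ntr (M1 *m M2^t*)).
rewrite -/(LT_of _ _ _ _ _ _).
have := cabs_ntr_sub_conj_sqr N_gt0 l1 l2.
have := beta_conj_sqr_le pair z1_gt0 z2_gt0 nM2.
have := cabs_ge0 (1 - ntr (M1 *m M2)).
have := cabs_ge0 (1 - ntr (M1 *m M2^t*)).
have : 0 <= 16 + 16 * C0 ^+ 2 * (2 * L + 2) ^+ 4.
  by rewrite addr_ge0 // mulr_ge0 ?exprn_even_ge0 // mulr_ge0 ?sqr_ge0.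
move: (16 + _) (cabs (ntr M1 - _)) (LT_of _ _ _ _ _ _).
move: (cabs (1 - ntr (M1 *m M2^t*))) (cabs (1 - _)).
clear => b b' A d t A0 b0 b'0 h1 h2 t1 h3.
rewrite mulrDl -mulrA; case: h3 => h3; first by nra.
by have := sqr_ge0 (d - b); nra.
Qed.

Lemma pi_ge1 : 1 <= pi :> R.
Proof. by have := pi_ge2 R; clear => *; lra. Qed.

(** The ratio [eta / rho] is truncated, so it is comparable to the defect
    [1 - hs2 M = eta / (eta + q)] with [q = pi * rho]. *)
Lemma eta_rho_le (eta q : R) : 0 < eta -> 0 < q ->
  Num.min (eta / (pi^-1 * q)) 1 <= (1 + pi) * (eta / (eta + q)).
Proof.
move=> e0 q0; have p1 := pi_ge1; have p0 := pi_gt0 R.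
have [x0 xE] : 0 <= eta / (eta + q) /\ eta / (eta + q) * (eta + q) = eta.
  by rewrite divr_ge0 ?divfK ?gt_eqF ?addr_gt0 // ltW ?addr_gt0.
move: (eta / (eta + q)) x0 xE => x x0 xE.
rewrite invfM invrK; move: (pi) p1 p0 => p p1 p0.
rewrite ge_min; apply/orP; have [h|h] := leP (p * eta) q; [left|right; nra].
by rewrite mulrA ler_pdivrMr //; nra.
Qed.

End StabilityBounds.

(** * Upper bound on the stability factor *)

Section Stability.
Context {R : realType}.
Local Notation C := R[i].

Lemma cabs_le_Re_Im (x : C) : cabs x <= `|complex.Re x| + `|complex.Im x|.
Proof.
apply: le_of_sqr_le; first by rewrite addr_ge0.
rewrite cabs_sqr sqrrD !real_normK ?num_real // lerD2r lerDl.
by rewrite mulrn_wge0 // mulr_ge0.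
Qed.

(** [M1 - M2' = M1 ((w1 - conj w2) - (D1 - D2)) M2']. *)
Lemma hs_sub_trmxC_le C0 L N (D1 D2 : 'M[C]_N) z1 z2 M1 M2 :
  dyson_pair L D1 D2 z1 z2 M1 M2 -> opnorm M1 <= C0 -> opnorm M2 <= C0 ->
  hs (M1 - M2^t*) <=
  C0 ^+ 2 * (cabs (z1 + ntr M1 - ((z2 + ntr M2)^*)%C) + hs (D1 - D2)).
Proof.
move=> pair n1 n2; have [N_gt0 _ _ s1 _] := pair.
have [_ _ _ _ s2] := dyson_pair_trmxC pair.
have [_ r1] := MDE_solution_resolvent s1.
have [l2 _] := MDE_solution_resolvent s2.
have C0_ge0 : 0 <= C0 by exact: le_trans (opnorm_ge0 M1) n1.
rewrite (resolvent_identity r1 l2) sub_shifts -mulmxA ntr_trmxC -rmorphD /=.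
rewrite (le_trans (hs_mulmxl _ _)) // expr2 -mulrA.
apply: ler_pM; rewrite ?opnorm_ge0 ?hs_ge0 //.
rewrite (le_trans (hs_mulmxr _ _)) // trmxCK.
apply: ler_pM; rewrite ?opnorm_ge0 ?hs_ge0 //.
by rewrite (le_trans (hsB N_gt0 _ _)) // hs_scalar.
Qed.

(** [<M1 M2>] is compared with [<M1 M1'> = hs2 M1]. *)
Lemma beta_le_hs_sub L N (D1 D2 : 'M[C]_N) z1 z2 M1 M2 :
  dyson_pair L D1 D2 z1 z2 M1 M2 ->
  cabs (1 - ntr (M1 *m M2)) <= (1 - hs2 M1) + hs (M1 - M2^t*).
Proof.
move=> pair; have [N_gt0 _ _ _ _] := pair.
have [h1 _] := dyson_pair_hs2_le1 pair; have [h2 _] := dyson_pair_hs_le1 pair.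
have -> : 1 - ntr (M1 *m M2) =
    (1 - hs2 M1)%:C%C + ntr (M1 *m (M1 - M2^t*)^t*).
  rewrite trmxCD trmxCN trmxCK mulmxBr ntrB ntr_hs2 rmorphB /=.
  by rewrite addrA subrK.
rewrite (le_trans (cabsD _ _)) // cabs_real ger0_norm ?subr_ge0 // lerD2l.
rewrite (le_trans (cauchy_schwarz_ntr N_gt0 _ _)) //.
by rewrite ler_piMl ?hs_ge0.
Qed.

Lemma one_sub_hs2_le_eta_rho N (D M : 'M[C]_N) z : (0 < N)%N -> D^t* = D ->
  MDE_solution D z M -> 0 < complex.Im z ->
  1 - hs2 M <= complex.Im z / (pi^-1 * complex.Im (ntr M)).
Proof.
move=> N_gt0 hD s z0; have q0 := MDE_solution_Im_ntr_gt0 N_gt0 s z0.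
rewrite (MDE_solution_one_sub_hs2 N_gt0 hD s) !gtr0_norm //.
rewrite ler_pM2l // lef_pV2 ?posrE ?addr_gt0 ?mulr_gt0 ?invr_gt0 ?pi_gt0 //.
apply: (@le_trans _ _ (complex.Im (ntr M))); last by rewrite lerDr ltW.
by rewrite ler_piMl ?(ltW q0) // invf_le1 ?pi_gt0 // pi_ge1.
Qed.

(** The product of [|m1 - conj m2|] and the conjugate stability factor is at
    most [g], so one of the two factors is at most [sqrt g]. *)
Lemma beta_star_le_sqrt C0 L N (D1 D2 : 'M[C]_N) z1 z2 M1 M2 (g : R) :
  dyson_pair L D1 D2 z1 z2 M1 M2 -> opnorm M1 <= C0 -> opnorm M2 <= C0 ->
  0 < complex.Im z1 -> 0 < complex.Im z2 -> g < 1 ->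
  hs2 (D1 - D2) <= g -> LT_of D1 D2 z1 z2 M1 M2 <= g ->
  Num.min (`|complex.Re z1 - complex.Re z2| ^+ 2) 1 <= g ->
  Num.min (complex.Im z1 / (pi^-1 * complex.Im (ntr M1))) 1 <= g ->
  Num.min (complex.Im z2 / (pi^-1 * complex.Im (ntr M2))) 1 <= g ->
  Num.min (cabs (1 - ntr (M1 *m M2))) (cabs (1 - ntr (M1 *m M2^t*))) <=
  (1 + 5 * C0 ^+ 2) * Num.sqrt g.
Proof.
move=> pair n1 n2 z1_gt0 z2_gt0 g1 hD hT hE he1 he2.
have [N_gt0 /admissible_trmxC hD1 _ sol1 sol2] := pair.
have [M1_le1 M2_le1] := dyson_pair_hs_le1 pair.
have minE (a : R) : Num.min a 1 <= g -> a <= g.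
  by rewrite ge_min leNgt [1 <= g]leNgt g1 orbF -leNgt.
move: hE he1 he2 => /minE hE /minE he1 /minE he2.
have g0 : 0 <= g by apply: le_trans hE; rewrite sqr_ge0.
set s := Num.sqrt g; have s0 : 0 <= s by exact: sqrtr_ge0.
have sE : s ^+ 2 = g by exact: sqr_sqrtr.
have gs : g <= s by rewrite -sE; move: g1; rewrite -sE; clear -s0; nra.
have C0_ge0 : 0 <= C0 ^+ 2 by exact: sqr_ge0.
have [hb|hb] := leP (cabs (1 - ntr (M1 *m M2^t*))) s.
  rewrite ge_min; apply/orP; right; rewrite (le_trans hb) //.
  by move: s0 C0_ge0; move: (C0 ^+ 2) (s); clear => *; nra.
have eta_le (z : C) (M : 'M[C]_N) : hs M <= 1 -> 0 < complex.Im (ntr M) ->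
    complex.Im z / (pi^-1 * complex.Im (ntr M)) <= g -> complex.Im z <= s.
  move=> hM q0; rewrite ler_pdivrMr ?mulr_gt0 ?invr_gt0 ?pi_gt0 // => h.
  apply: (le_trans h); apply: le_trans gs; rewrite ler_piMr //.
  rewrite mulr_ile1 ?invr_ge0 ?(ltW q0) ?(ltW (pi_gt0 _)) //.
    by rewrite invf_le1 ?pi_gt0 // pi_ge1.
  apply: le_trans hM; apply: le_trans (cabs_ntr_le_hs N_gt0 M).
  exact: le_trans (ler_norm _) (Im_le_cabs _).
have q1 := MDE_solution_Im_ntr_gt0 N_gt0 sol1 z1_gt0.
have q2 := MDE_solution_Im_ntr_gt0 N_gt0 sol2 z2_gt0.
have e1 := eta_le _ _ M1_le1 q1 he1; have e2 := eta_le _ _ M2_le1 q2 he2.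
have hd : cabs (ntr M1 - ((ntr M2)^*)%C) <= s.
  have hbb : cabs (ntr (M1 *m M2^t*)) <= 1.
    have := dyson_pair_hs2_le1 (dyson_pair_trmxC pair).
    by case=> h1 h2; exact: cabs_ntr_mul_le1.
  have := trunc_dist_lt1 (ntr_sub_mul_trmxC pair) hbb (le_lt_trans hT g1).
  move=> /le_trans/(_ hT); rewrite -sE; move: hb s0.
  have := cabs_ge0 (ntr M1 - ((ntr M2)^*)%C).
  move: (cabs _) (cabs _) (s); clear => d b s d0 sb s0 h.
  (* [d * b <= s ^ 2] while [s < b]. *)
  by rewrite leNgt; apply/negP => sd; nra.
have hx : `|complex.Re z1 - complex.Re z2| <= s.
  by apply: le_of_sqr_le => //; rewrite sE.
have hDs : hs (D1 - D2) <= s by rewrite ler_wsqrtr.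
(* One [s] for each of the real part, [eta1], [eta2] and the traces. *)
have hw : cabs (z1 + ntr M1 - ((z2 + ntr M2)^*)%C) <= 4 * s.
  rewrite rmorphD /= opprD addrACA (le_trans (cabsD _ _)) //.
  have := cabs_le_Re_Im (z1 - (z2^*)%C).
  rewrite cReD cImD cReN cImN cReJ cImJ opprK.
  rewrite (gtr0_norm (addr_gt0 z1_gt0 z2_gt0)); move: hx e1 e2 hd.
  by clear => *; lra.
have hh := hs_sub_trmxC_le pair n1 n2.
have hb1 := beta_le_hs_sub pair.
have h1 : 1 - hs2 M1 <= s.
  apply: le_trans (le_trans he1 gs).
  exact: one_sub_hs2_le_eta_rho N_gt0 hD1 sol1 z1_gt0.
rewrite ge_min; apply/orP; left.
move: hw hDs hh hb1 h1 C0_ge0; move: (C0 ^+ 2) (s) (cabs _) (hs _) (hs _).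
by clear => *; nra.
Qed.

End Stability.

(** * Assembling the estimates *)

Section Assembly.
Context {R : realType}.
Local Notation C := R[i].
Implicit Types (L : R) (z : C).

Lemma beta_conjE N (D1 D2 : 'M[C]_N) z1 z2 : (0 < N)%N -> D2^t* = D2 ->
  beta D1 D2 z1 (z2^*)%C = cabs (1 - ntr (MDE D1 z1 *m (MDE D2 z2)^t*)).
Proof. by move=> N_gt0 hD; rewrite /beta MDE_conj. Qed.

Lemma LTE N (D1 D2 : 'M[C]_N) z1 z2 : 0 < complex.Im z1 -> 0 < complex.Im z2 ->
  LT D1 D2 z1 z2 = LT_of D1 D2 z1 z2 (MDE D1 z1) (MDE D2 z2).
Proof. by move=> h1 h2; rewrite /LT ltNge ltW ?mulr_gt0. Qed.

Lemma gamma_hatE N (D1 D2 : 'M[C]_N) z1 z2 :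
  (0 < N)%N -> D1^t* = D1 -> D2^t* = D2 ->
  0 < complex.Im z1 -> 0 < complex.Im z2 ->
  gamma_hat D1 D2 z1 z2 =
  hs2 (D1 - D2) + LT_of D1 D2 z1 z2 (MDE D1 z1) (MDE D2 z2)
  + Num.min (`|complex.Re z1 - complex.Re z2| ^+ 2) 1
  + Num.min (complex.Im z1 / (pi^-1 * complex.Im (ntr (MDE D1 z1)))) 1
  + Num.min (complex.Im z2 / (pi^-1 * complex.Im (ntr (MDE D2 z2)))) 1.
Proof.
move=> N_gt0 hD1 hD2 h1 h2; rewrite /gamma_hat LTE // !rhoE.
by rewrite -{2}[D1 - D2]trmxCK trmxCD trmxCN hD1 hD2.
Qed.

Lemma MDE_pair_or_eq0 L N (D1 D2 : 'M[C]_N) z1 z2 :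
  (0 < N)%N -> admissible L D1 -> admissible L D2 ->
  dyson_pair L D1 D2 z1 z2 (MDE D1 z1) (MDE D2 z2) \/
  (MDE D1 z1 == 0) || (MDE D2 z2 == 0).
Proof.
move=> N_gt0 a1 a2; have [s1|->] := MDE_sol_or_eq0 D1 z1; last by right;
  rewrite eqxx.
have [s2|->] := MDE_sol_or_eq0 D2 z2; last by right; rewrite eqxx orbT.
by left; exact: And5 N_gt0 a1 a2 s1 s2.
Qed.

Lemma mulmx_eq0_of_eq0 N (M1 M2 : 'M[C]_N) : (M1 == 0) || (M2 == 0) ->
  M1 *m M2 = 0 /\ M1 *m M2^t* = 0.
Proof.
case/orP => /eqP ->; rewrite ?mul0mx // mulmx0; split=> //.
by rewrite trmx0 map_mx0 mulmx0.
Qed.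

Lemma MDE_hs2_le1_Im_ge0 L N (D : 'M[C]_N) z : (0 < N)%N -> admissible L D ->
  0 < complex.Im z -> hs2 (MDE D z) <= 1 /\ 0 <= complex.Im (ntr (MDE D z)).
Proof.
move=> N_gt0 /admissible_trmxC hD z0; have [s|->] := MDE_sol_or_eq0 D z.
  split; first exact: MDE_solution_hs2_le1 s.
  exact: ltW (MDE_solution_Im_ntr_gt0 N_gt0 s z0).
by rewrite ntr0 hs20 lexx ler01.
Qed.

Lemma rho_add_sqr_le L N (D1 D2 : 'M[C]_N) z1 z2 :
  (0 < N)%N -> admissible L D1 -> admissible L D2 ->
  0 < complex.Im z1 -> 0 < complex.Im z2 ->
  (rho D1 z1 + rho D2 z2) ^+ 2 <= 2 * pi^-1 ^+ 2 * beta D1 D2 z1 z2.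
Proof.
move=> N_gt0 a1 a2 h1 h2; have [l1 q1] := MDE_hs2_le1_Im_ge0 N_gt0 a1 h1.
have [l2 q2] := MDE_hs2_le1_Im_ge0 N_gt0 a2 h2.
rewrite !rhoE // -mulrDr exprMn (mulrC 2) -(mulrA _ 2) ler_wpM2l ?sqr_ge0 //.
apply: le_trans (cabs_ntr_sub_conj_sqr N_gt0 l1 l2).
apply: lerXn2r; last exact: Im_le_cabs_conj.
  by rewrite nnegrE (addr_ge0 q1 q2).
by rewrite nnegrE cabs_ge0.
Qed.

Lemma gamma_hat_bounded L N (D1 D2 : 'M[C]_N) z1 z2 :
  (0 < N)%N -> admissible L D1 -> admissible L D2 ->
  0 < complex.Im z1 -> 0 < complex.Im z2 ->
  gamma_hat D1 D2 z1 z2 <= 4 * L ^+ 2 + 4.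
Proof.
move=> N_gt0 a1 a2 h1 h2; have hD1 := admissible_trmxC a1.
rewrite gamma_hatE ?(admissible_trmxC a2) //.
have min_le1 (a : R) : Num.min a 1 <= 1 by rewrite ge_min lexx orbT.
rewrite (_ : 4 * L ^+ 2 + 4 = 4 * L ^+ 2 + 1 + 1 + 1 + 1); last by ring.
do 3 (apply: lerD; last exact: min_le1).
exact: lerD (hs2_sub_admissible_le N_gt0 a1 a2) (trunc_dist_le1 _ _ _).
Qed.

Lemma sum_le_add_const (d t x y1 y2 b c1 c2 c3 : R) :
  d + x <= c1 * b -> t <= c2 * b -> y1 <= c3 * b -> y2 <= c3 * b ->
  d + t + x + y1 + y2 <= (c1 + c2 + 2 * c3) * b.
Proof. by lra. Qed.

Definition gap_const L : R := 16 * L ^+ 2 + 4 * (2 * L + 2) ^+ 4 + 4.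

Definition LT_const L (C0 : R) : R :=
  2 + 4 * (16 + 16 * C0 ^+ 2 * (2 * L + 2) ^+ 4).

Definition gamma_const L (C0 : R) : R :=
  gap_const L + LT_const L C0 + 2 * (2 * (1 + pi)).

Lemma gap_const_ge L : 4 * L ^+ 2 + 4 <= gap_const L.
Proof.
have := sqr_ge0 L; have : 0 <= (2 * L + 2) ^+ 4 by rewrite exprn_even_ge0.
by rewrite /gap_const; move: (_ ^+ 4) (L ^+ 2) => *; lra.
Qed.

Lemma LT_const_ge4 L (C0 : R) : 4 <= LT_const L C0.
Proof.
have : 0 <= C0 ^+ 2 * (2 * L + 2) ^+ 4.
  by rewrite mulr_ge0 ?sqr_ge0 // exprn_even_ge0.
by rewrite /LT_const -[16 * C0 ^+ 2 * _]mulrA; move: (C0 ^+ 2 * _) => *; lra.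
Qed.

Lemma gamma_const_ge L (C0 : R) : 4 * L ^+ 2 + 4 <= gamma_const L C0.
Proof.
have := gap_const_ge L; have := LT_const_ge4 L C0; have := pi_ge0 R.
rewrite /gamma_const; move: (gap_const L) (LT_const L C0) (pi) (L ^+ 2) => *.
by lra.
Qed.

(** Except for [LT], the terms are bounded by the second stability factor just
    as by the first one, applying the estimates to the pair of solutions in
    which the second one is conjugated. *)
Lemma gamma_hat_le_beta L (C0 : R) N (D1 D2 : 'M[C]_N) z1 z2 :
  (0 < N)%N -> admissible L D1 -> admissible L D2 ->
  opnorm (MDE D2 z2) <= C0 ->
  0 < complex.Im z1 -> 0 < complex.Im z2 ->
  gamma_hat D1 D2 z1 z2 <= gamma_const L C0 * beta D1 D2 z1 z2 /\
  gamma_hat D1 D2 z1 z2 <= gamma_const L C0 * beta D1 D2 z1 (z2^*)%C.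
Proof.
move=> N_gt0 a1 a2 n2 h1 h2.
have [hD1 hD2] := (admissible_trmxC a1, admissible_trmxC a2).
rewrite beta_conjE // /beta.
case: (MDE_pair_or_eq0 z1 z2 N_gt0 a1 a2) => [pair|/mulmx_eq0_of_eq0 [-> ->]];
  last first.
  (* A vanishing [MDE] makes both stability factors equal to 1. *)
  rewrite ntr0 subr0 cabs1 mulr1; split;
  exact: le_trans (gamma_hat_bounded N_gt0 a1 a2 h1 h2) (gamma_const_ge _ _).
have eta_le b (D M : 'M[C]_N) z : D^t* = D -> MDE_solution D z M ->
    0 < complex.Im z -> 1 - hs2 M <= 2 * b ->
    Num.min (complex.Im z / (pi^-1 * complex.Im (ntr M))) 1 <= 2 * (1 + pi) * b.
  move=> hD s z0; have q0 := MDE_solution_Im_ntr_gt0 N_gt0 s z0.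
  rewrite (MDE_solution_one_sub_hs2 N_gt0 hD s) !gtr0_norm // => h.
  apply: (le_trans (eta_rho_le z0 q0)); rewrite [2 * _]mulrC -mulrA.
  by rewrite ler_wpM2l // addr_ge0 ?pi_ge0.
have [_ _ _ s1 s2] := pair.
have [l1 l2] := dyson_pair_hs2_le1 pair.
have [_ l2'] := dyson_pair_hs2_le1 (dyson_pair_trmxC pair).
rewrite gamma_hatE //; split.
  have [d1 d2 _] := defects_le_beta l1 l2.
  apply: sum_le_add_const (hs2_sub_add_Re_sub_sqr_le pair)
    (LT_of_le_beta pair h1 h2 n2) _ _.
    exact: eta_le hD1 s1 h1 d1.
  exact: eta_le hD2 s2 h2 d2.
have [d1 d2 _] := defects_le_beta l1 l2'; rewrite hs2_trmxC in d2.
have := hs2_sub_add_Re_sub_sqr_le (dyson_pair_trmxC pair); rewrite cReJ => he.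
apply: sum_le_add_const he _ _ _.
- apply: (le_trans (LT_of_le_beta_conj pair)).
  by rewrite ler_wpM2r ?cabs_ge0 ?LT_const_ge4.
- exact: eta_le hD1 s1 h1 d1.
- exact: eta_le hD2 s2 h2 d2.
Qed.

Lemma beta_star_ge0 N (D1 D2 : 'M[C]_N) z1 z2 : 0 <= beta_star D1 D2 z1 z2.
Proof. by rewrite le_min; apply/andP; split; exact: cabs_ge0. Qed.

Lemma le_mul_min (g c b b' : R) :
  g <= c * b -> g <= c * b' -> g <= c * Num.min b b'.
Proof. by move=> h h'; have [] := leP b b'. Qed.

Lemma sqrt_le_powR_quarter (g : R) : 0 <= g -> g <= 1 ->
  Num.sqrt g <= g `^ (4^-1).
Proof.
move=> g0 g1; have [->|g_neq0] := eqVneq g 0; first by rewrite sqrtr0 powR_ge0.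
rewrite -powR12_sqrt //; apply: ger_powR; first by rewrite g1 lt_def g_neq0 g0.
by rewrite lef_pV2 ?posrE // ler_nat.
Qed.

Lemma le_sum_nneg (d t x y1 y2 : R) :
  0 <= d -> 0 <= t -> 0 <= x -> 0 <= y1 -> 0 <= y2 ->
  let s := d + t + x + y1 + y2 in
  [/\ d <= s, t <= s, x <= s, y1 <= s & y2 <= s] /\ 0 <= s.
Proof. by move=> d0 t0 x0 y0 y0' s; rewrite /s; do ?split; lra. Qed.

Lemma beta_star_le L (C0 : R) N (D1 D2 : 'M[C]_N) z1 z2 :
  (0 < N)%N -> admissible L D1 -> admissible L D2 ->
  opnorm (MDE D1 z1) <= C0 -> opnorm (MDE D2 z2) <= C0 ->
  0 < complex.Im z1 -> 0 < complex.Im z2 ->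
  beta_star D1 D2 z1 z2 <= (2 + 5 * C0 ^+ 2) * gamma_hat D1 D2 z1 z2 `^ (4^-1).
Proof.
move=> N_gt0 a1 a2 n1 n2 h1 h2.
have [hD1 hD2] := (admissible_trmxC a1, admissible_trmxC a2).
have C0_ge0 := sqr_ge0 C0.
rewrite /beta_star beta_conjE // /beta.
have [g1|g1] := leP 1 (gamma_hat D1 D2 z1 z2).
  have p1 : 1 <= gamma_hat D1 D2 z1 z2 `^ (4^-1).
    have : (1 : R) `^ (4^-1) <= gamma_hat D1 D2 z1 z2 `^ (4^-1).
      by apply: ge0_ler_powR; rewrite ?nnegrE ?invr_ge0 ?(le_trans ler01 g1).
    by rewrite powR1.
  have [l1 _] := MDE_hs2_le1_Im_ge0 N_gt0 a1 h1;
    have [l2 _] := MDE_hs2_le1_Im_ge0 N_gt0 a2 h2.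
  rewrite ge_min; apply/orP; left;
    rewrite (le_trans (cabs_one_sub_le2 _ l1 l2)) //.
  by move: C0_ge0 p1; move: (C0 ^+ 2) (_ `^ _); clear => *; nra.
have min_ge0 (a : R) : 0 <= a -> 0 <= Num.min a 1.
  by move=> a0; rewrite le_min a0 ler01.
have eta_ge0 (D : 'M[C]_N) z : admissible L D -> 0 < complex.Im z ->
    0 <= Num.min (complex.Im z / (pi^-1 * complex.Im (ntr (MDE D z)))) 1.
  move=> a z0; apply: min_ge0; have [_ q0] := MDE_hs2_le1_Im_ge0 N_gt0 a z0.
  by rewrite divr_ge0 ?mulr_ge0 ?invr_ge0 ?pi_ge0 // ltW.
have := le_sum_nneg (hs2_ge0 (D1 - D2))
  (trunc_dist_ge0 _ _ _ : 0 <= LT_of D1 D2 z1 z2 (MDE D1 z1) (MDE D2 z2))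
  (min_ge0 _ (sqr_ge0 `|complex.Re z1 - complex.Re z2|))
  (eta_ge0 _ _ a1 h1) (eta_ge0 _ _ a2 h2).
rewrite -gamma_hatE // => -[[d_le t_le x_le y1_le y2_le] g0].
have [pair|/mulmx_eq0_of_eq0 [_ e]] := MDE_pair_or_eq0 z1 z2 N_gt0 a1 a2;
  last first.
  by move: (le_lt_trans t_le g1); rewrite /LT_of /trunc_dist e ntr0 eqxx ltxx.
have := beta_star_le_sqrt pair n1 n2 h1 h2 g1 d_le t_le x_le y1_le y2_le.
move=> h; apply: (le_trans h).
apply: ler_pM; rewrite ?sqrtr_ge0 //.
- by move: C0_ge0; clear => *; lra.
- by move: C0_ge0; clear => *; lra.
exact: sqrt_le_powR_quarter g0 (ltW g1).
Qed.

End Assembly.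

Theorem proposition3p1 (R : realType) (L : R) (hL : 0 < L) :
  (exists2 C : R, 0 < C &
    forall (N : nat) (D1 D2 : 'M[R[i]]_N), (0 < N)%N ->
    admissible L D1 -> admissible L D2 ->
    forall z1 z2 : R[i], 0 < complex.Im z1 -> 0 < complex.Im z2 ->
    (rho D1 z1 + rho D2 z2) ^+ 2 <= C * beta D1 D2 z1 z2)
  /\
  (forall C0 : R, 0 < C0 ->
    exists2 C : R, 0 < C &
    forall (N : nat) (D1 D2 : 'M[R[i]]_N), (0 < N)%N ->
    admissible L D1 -> admissible L D2 ->
    forall I1 I2 : interval R,
    MDE_bounded C0 D1 I1 -> MDE_bounded C0 D2 I2 ->
    forall z1 z2 : R[i], 0 < complex.Im z1 -> 0 < complex.Im z2 ->
    complex.Re z1 \in I1 -> complex.Re z2 \in I2 ->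
    gamma_hat D1 D2 z1 z2 <= C * beta_star D1 D2 z1 z2 /\
    beta_star D1 D2 z1 z2 <= C * (gamma_hat D1 D2 z1 z2) `^ (4^-1)).
Proof.
split.
  exists (2 * pi^-1 ^+ 2);
    first by rewrite mulr_gt0 // exprn_gt0 // invr_gt0 pi_gt0.
  move=> N D1 D2 N_gt0 a1 a2 z1 z2 h1 h2.
  exact: rho_add_sqr_le N_gt0 a1 a2 h1 h2.
move=> C0 _; have C0_ge0 := sqr_ge0 C0.
have low_ge0 : 0 <= gamma_const L C0.
  by have := gamma_const_ge L C0; have := sqr_ge0 L; lra.
have up_gt0 : 0 < 2 + 5 * C0 ^+ 2 by move: C0_ge0; clear => *; lra.
exists (gamma_const L C0 + (2 + 5 * C0 ^+ 2));
  first exact: ltr_wpDl low_ge0 up_gt0.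
move=> N D1 D2 N_gt0 a1 a2 I1 I2 bd1 bd2 z1 z2 h1 h2 i1 i2.
have n1 := bd1 z1 i1 (lt0r_neq0 h1); have n2 := bd2 z2 i2 (lt0r_neq0 h2).
split.
  have [g1 g2] := gamma_hat_le_beta N_gt0 a1 a2 n2 h1 h2.
  apply: (@le_trans _ _ (gamma_const L C0 * beta_star D1 D2 z1 z2)).
    exact: le_mul_min g1 g2.
  by apply: ler_wpM2r; [exact: beta_star_ge0 | rewrite lerDl (ltW up_gt0)].
apply: (le_trans (beta_star_le N_gt0 a1 a2 n1 n2 h1 h2)).
by apply: ler_wpM2r; [exact: powR_ge0 | rewrite lerDr].
Qed.
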